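(* Let $X$ be a finite connected poset and $F$ a field with $\mathrm{char}(F)\notin\{2,3\}$. Then every bijective $F$-linear map $\varphi:I(X,F)\to I(X,F)$ with $\varphi(T(I(X,F)))\subseteq T(I(X,F))$ is of the form $\varphi=r\psi$, where $r\in\{-1,1\}$ and $\psi$ is either an automorphism or an anti-automorphism of $I(X,F)$.
   Context: $I(X,F)$ is the incidence algebra of the locally finite poset $X$ over $F$ (functions $f:X\times X\to F$ vanishing unless $x\le y$, with product $(fg)(x,y)=\sum_{x\le z\le y}f(x,z)g(z,y)$). A poset is connected if any two elements are joined by a finite sequence of elements in which consecutive elements are comparable. $T(A)=\{a: a^3=a\}$ denotes the tripotents of $A$. *)

(* Defs.v *)
From HB Require Import structures.
From mathcomp Require Import all_boot all_order all_algebra.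
Set Implicit Arguments. Unset Strict Implicit. Unset Printing Implicit Defensive.
Import Order.TTheory GRing.Theory.
Local Open Scope ring_scope.
Local Open Scope order_scope.

Section Incidence.
Context {d : Order.disp_t} (X : finPOrderType d) (F : fieldType).

Definition is_inc (f : {ffun X * X -> F}) : bool :=
  [forall p : X * X, ~~ (p.1 <= p.2) ==> (f p == 0%R)].

Record incidence := Inc { incf :> {ffun X * X -> F}; incP : is_inc incf }.

Definition mk_fun (g : X -> X -> F) : {ffun X * X -> F} :=
  [ffun p : X * X => if p.1 <= p.2 then g p.1 p.2 else 0%R].

Lemma mk_funP g : is_inc (mk_fun g).
Proof.
apply/forallP => p; apply/implyP => /negbTE H.
by rewrite /mk_fun ffunE H.
Qed.

Definition mk g : incidence := Inc (mk_funP g).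

Definition inc_add (f g : incidence) : incidence :=
  mk (fun x y => (f (x, y) + g (x, y))%R).
Definition inc_scale (a : F) (f : incidence) : incidence :=
  mk (fun x y => (a * f (x, y))%R).
Definition inc_mul (f g : incidence) : incidence :=
  mk (fun x y => (\sum_(z : X | ((x <= z)%O && (z <= y)%O)%B) f (x, z) * g (z, y))%R).
Definition inc_one : incidence := mk (fun x y => if x == y then 1%R else 0%R).

Definition tripotent (f : incidence) : Prop := inc_mul f (inc_mul f f) = f.

Definition F_linear (phi : incidence -> incidence) : Prop :=
  (forall f g, phi (inc_add f g) = inc_add (phi f) (phi g)) /\
  (forall a f, phi (inc_scale a f) = inc_scale a (phi f)).

Definition inc_automorphism (psi : incidence -> incidence) : Prop :=
  [/\ F_linear psi, bijective psi, psi inc_one = inc_one &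
      forall f g, psi (inc_mul f g) = inc_mul (psi f) (psi g)].
Definition inc_antiautomorphism (psi : incidence -> incidence) : Prop :=
  [/\ F_linear psi, bijective psi, psi inc_one = inc_one &
      forall f g, psi (inc_mul f g) = inc_mul (psi g) (psi f)].

End Incidence.

Definition poset_connected {d : Order.disp_t} (X : finPOrderType d) : Prop :=
  forall x y : X, connect (fun a b : X => (a >=< b)%O) x y.

(* Main.v *)
(** If a, b and a +- b are tripotents, then ab = ba = 0 as soon as 2 and 3 are
    invertible, so phi preserves orthogonality of idempotents.  Applied to f
    and 1 - f this makes phi(1) commute with phi(f) for every idempotent f;
    idempotents span I(X, F), so phi(1) is central, hence a scalar c, and
    c^3 = c gives c = 1 or c = -1.

    Now psi = c phi is unital and preserves orthogonality.  The E_x = psi(e_xx)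
    are orthogonal idempotents with sum 1, and their diagonals define a
    permutation pi of X such that E_x I(X, F) E_y <> 0 iff pi x <= pi y.
    For x < y, N_xy = psi(e_xy) is E_x N_xy + E_y N_xy with E_x N_xy = N_xy E_y
    and E_y N_xy = N_xy E_x.  Only one of the two summands can survive,
    according to whether pi preserves or reverses x < y, and
    N_xz E_z = N_xy N_yz, E_z N_xz = N_yz N_xy for x < y < z.  Since N_xz <> 0,
    consecutive pairs of a chain have the same orientation; surjectivity of psi
    shows that pi reflects comparability, which settles pairs x < y, x < z (and
    dually).  By connectedness pi is monotone (psi is multiplicative) or
    antitone (psi is antimultiplicative). *)
Require Import Defs.
From HB Require Import structures.
From mathcomp Require Import all_boot all_order all_algebra.
Local Open Scope ring_scope.
Set Implicit Arguments. Unset Strict Implicit. Unset Printing Implicit Defensive.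
Import Order.TTheory GRing.Theory.

(** * Tripotents in rings without 2- and 3-torsion *)

Lemma tripotent_orthogonal (R : pzRingType) (a b : R) :
  (forall x : R, x *+ 2 = 0 -> x = 0) -> (forall x : R, x *+ 3 = 0 -> x = 0) ->
  a * (a * a) = a -> b * (b * b) = b ->
  (a + b) * ((a + b) * (a + b)) = a + b ->
  (a - b) * ((a - b) * (a - b)) = a - b ->
  a * b = 0 /\ b * a = 0.
Proof.
move=> R2 R3 a3 b3 abD abB.
pose s := a * a + b * b; pose k := a * b + b * a.
have sqD : (a + b) * (a + b) = s + k.
  by rewrite mulrDl !mulrDr [b * a + b * b]addrC addrACA.
have sqB : (a - b) * (a - b) = s - k.
  by rewrite mulrBl !mulrBr opprB addrACA -opprD.
have split4 (p q r t : R) :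
    ((p + q) + (r + t)) + ((p - q) - (r - t)) = (p + t) *+ 2.
  have -> : p - q - (r - t) = p + t - (q + r) by rewrite opprB addrACA -opprD.
  have -> : p + q + (r + t) = p + t + (q + r) by rewrite [r + t]addrC addrACA.
  by rewrite addrACA subrr addr0 mulr2n.
(* Adding the cubes of [a + b] and [a - b] keeps only the terms even in [b]: [2 (a s + b k) = 2 a],
   where [a * (a * a) = a] cancels. *)
have Q0 : a * (b * b) + (b * (a * b) + b * (b * a)) = 0.
  have abk : (a * s + b * k - a) *+ 2 = 0.
    rewrite mulrnBl -(split4 _ (a * k) (b * s)).
    rewrite -!mulrDr -!mulrBr -mulrDl -mulrBl -sqD -sqB abD abB.
    by rewrite addrACA subrr addr0 -mulr2n subrr.
  by rewrite -(R2 _ abk) /s /k !mulrDr a3 -[a + _ + _]addrA [a + _]addrC addrK.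
(* Multiplying [Q0] by [b] on the left and on the right gives the same two terms, plus [b * a] and
   [a * b] respectively. Once [a] and [b] commute, [Q0] reads [3 a b^2 = 0]. *)
have ba : b * a = a * b.
  have b3a : b * (b * (b * a)) = b * a by rewrite [b * (b * a)]mulrA mulrA b3.
  have Ql : b * (a * (b * b)) + b * (b * (a * b)) + b * a = 0.
    by rewrite -(mulr0 b) -Q0 !mulrDr b3a addrA.
  have Qr : b * (a * (b * b)) + b * (b * (a * b)) + a * b = 0.
    by rewrite -(mul0r b) -Q0 !mulrDl -!mulrA b3 addrC.
  by apply: (addrI (b * (a * (b * b)) + b * (b * (a * b)))); rewrite Ql.
suff ab0 : a * b = 0 by rewrite ba.
have abb : a * (b * b) = 0.
  by apply: R3; rewrite -[RHS]Q0 ba [in b * (a * b)]mulrA ba -mulrA mulrSr mulr2n addrA.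
by rewrite -b3 [b * (b * b)]mulrA mulrA abb mul0r.
Qed.

(** * Ring and vector space structure of the incidence algebra *)

Section IncidenceAlgebra.
Context {d : Order.disp_t} (X : finPOrderType d) (F : fieldType).
Local Notation A := (incidence X F).

#[local] Arguments incf : simpl never.

HB.instance Definition _ := [isSub for @incf d X F].
HB.instance Definition _ := [Choice of A by <:].

Lemma inc_out (f : A) x y : ~~ (x <= y)%O -> f (x, y) = 0.
Proof. by move=> xy; have /forallP/(_ (x, y))/implyP/(_ xy)/eqP := incP f. Qed.

Lemma inc_ext (f g : A) : (forall x y, f (x, y) = g (x, y)) -> f = g.
Proof. by move=> fg; apply/val_inj/ffunP => -[x y]; apply: fg. Qed.

Lemma mkE h x y : (mk h : A) (x, y) = if (x <= y)%O then h x y else 0.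
Proof. by rewrite ffunE. Qed.

Definition inc_zero : A := mk (fun _ _ => 0).
Definition inc_opp (f : A) : A := mk (fun x y => - f (x, y)).

Lemma inc_addE (f g : A) x y : inc_add f g (x, y) = f (x, y) + g (x, y).
Proof. by rewrite mkE; case: ifPn => // xy; rewrite !inc_out ?addr0. Qed.

Lemma inc_oppE (f : A) x y : inc_opp f (x, y) = - f (x, y).
Proof. by rewrite mkE; case: ifPn => // xy; rewrite !inc_out ?oppr0. Qed.

Lemma inc_scaleE a (f : A) x y : inc_scale a f (x, y) = a * f (x, y).
Proof. by rewrite mkE; case: ifPn => // xy; rewrite !inc_out ?mulr0. Qed.

Lemma inc_zeroE x y : inc_zero (x, y) = 0.
Proof. by rewrite mkE if_same. Qed.

Lemma inc_oneE x y : (inc_one X F) (x, y) = (x == y)%:R.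
Proof.
rewrite mkE; case: (eqVneq x y) => [->|_]; first by rewrite lexx.
by rewrite if_same.
Qed.

(** Terms outside the interval vanish by [inc_out], so the product is an unrestricted matrix
    product. *)
Lemma inc_mulE (f g : A) x y : inc_mul f g (x, y) = \sum_z f (x, z) * g (z, y).
Proof.
have -> : \sum_z f (x, z) * g (z, y)
        = \sum_(z | ((x <= z) && (z <= y))%O) f (x, z) * g (z, y).
  rewrite [RHS]big_mkcond; apply: eq_bigr => z _; case: ifPn => //.
  by rewrite negb_and => /orP[] xz; rewrite (inc_out _ xz) ?mul0r ?mulr0.
rewrite mkE; case: ifPn => // xy; rewrite big_pred0 // => z.
by apply: contraNF xy => /andP[]; apply: le_trans.
Qed.

Lemma inc_addA : associative (@inc_add d X F).
Proof. by move=> f g h; apply: inc_ext => x y; rewrite !inc_addE addrA. Qed.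

Lemma inc_addC : commutative (@inc_add d X F).
Proof. by move=> f g; apply: inc_ext => x y; rewrite !inc_addE addrC. Qed.

Lemma inc_add0 : left_id inc_zero (@inc_add d X F).
Proof. by move=> f; apply: inc_ext => x y; rewrite inc_addE inc_zeroE add0r. Qed.

Lemma inc_addN : left_inverse inc_zero inc_opp (@inc_add d X F).
Proof.
by move=> f; apply: inc_ext => x y; rewrite inc_addE inc_oppE inc_zeroE addNr.
Qed.

HB.instance Definition _ :=
  GRing.isZmodule.Build A inc_addA inc_addC inc_add0 inc_addN.

Lemma inc_mulA : associative (@inc_mul d X F).
Proof.
move=> f g h; apply: inc_ext => x y; rewrite !inc_mulE.
under eq_bigr do rewrite inc_mulE big_distrr /=.
rewrite exchange_big /=; apply: eq_bigr => z _; rewrite inc_mulE big_distrl /=.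
by apply: eq_bigr => w _; rewrite mulrA.
Qed.

Lemma inc_mul1l : left_id (inc_one X F) (@inc_mul d X F).
Proof.
move=> f; apply: inc_ext => x y; rewrite inc_mulE (bigD1 x) //= inc_oneE eqxx.
rewrite mul1r big1 ?addr0 // => z; rewrite inc_oneE eq_sym => /negbTE ->.
by rewrite mul0r.
Qed.

Lemma inc_mul1r : right_id (inc_one X F) (@inc_mul d X F).
Proof.
move=> f; apply: inc_ext => x y; rewrite inc_mulE (bigD1 y) //= inc_oneE eqxx.
by rewrite mulr1 big1 ?addr0 // => z; rewrite inc_oneE => /negbTE ->; rewrite mulr0.
Qed.

Lemma inc_mulDl : left_distributive (@inc_mul d X F) (@inc_add d X F).
Proof.
move=> f g h; apply: inc_ext => x y; rewrite inc_addE !inc_mulE -big_split /=.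
by apply: eq_bigr => z _; rewrite inc_addE mulrDl.
Qed.

Lemma inc_mulDr : right_distributive (@inc_mul d X F) (@inc_add d X F).
Proof.
move=> f g h; apply: inc_ext => x y; rewrite inc_addE !inc_mulE -big_split /=.
by apply: eq_bigr => z _; rewrite inc_addE mulrDr.
Qed.

HB.instance Definition _ := GRing.Zmodule_isPzRing.Build A
  inc_mulA inc_mul1l inc_mul1r inc_mulDl inc_mulDr.

Lemma inc_scaleA a b (f : A) : inc_scale a (inc_scale b f) = inc_scale (a * b) f.
Proof. by apply: inc_ext => x y; rewrite !inc_scaleE mulrA. Qed.

Lemma inc_scale1 : left_id 1 (@inc_scale d X F).
Proof. by move=> f; apply: inc_ext => x y; rewrite inc_scaleE mul1r. Qed.

Lemma inc_scaleDr : right_distributive (@inc_scale d X F) +%R.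
Proof.
by move=> a f g; apply: inc_ext => x y; rewrite !(inc_scaleE, inc_addE) mulrDr.
Qed.

Lemma inc_scaleDl (f : A) : {morph (@inc_scale d X F)^~ f : a b / a + b}.
Proof.
by move=> a b; apply: inc_ext => x y; rewrite !(inc_scaleE, inc_addE) mulrDl.
Qed.

HB.instance Definition _ := GRing.Zmodule_isLmodule.Build F A
  inc_scaleA inc_scale1 inc_scaleDr inc_scaleDl.

Lemma inc_scaleAl a (f g : A) : a *: (f * g) = (a *: f) * g.
Proof.
apply: inc_ext => x y; rewrite inc_scaleE !inc_mulE big_distrr /=.
by apply: eq_bigr => z _; rewrite inc_scaleE mulrA.
Qed.

Lemma inc_scaleAr a (f g : A) : a *: (f * g) = f * (a *: g).
Proof.
apply: inc_ext => x y; rewrite inc_scaleE !inc_mulE big_distrr /=.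
by apply: eq_bigr => z _; rewrite inc_scaleE mulrCA.
Qed.

Lemma inc0E x y : (0 : A) (x, y) = 0.
Proof. exact: inc_zeroE. Qed.

Lemma incDE (f g : A) x y : (f + g) (x, y) = f (x, y) + g (x, y).
Proof. exact: inc_addE. Qed.

Lemma incZE a (f : A) x y : (a *: f) (x, y) = a * f (x, y).
Proof. exact: inc_scaleE. Qed.

Lemma incME (f g : A) x y : (f * g) (x, y) = \sum_z f (x, z) * g (z, y).
Proof. exact: inc_mulE. Qed.

Lemma inc1E x y : (1 : A) (x, y) = (x == y)%:R.
Proof. exact: inc_oneE. Qed.

Lemma inc_sumE I (r : seq I) (P : pred I) (f : I -> A) x y :
  (\sum_(i <- r | P i) f i) (x, y) = \sum_(i <- r | P i) f i (x, y).
Proof.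
apply: (big_morph (fun g : A => g (x, y))) => [g h|]; first exact: incDE.
exact: inc0E.
Qed.

Lemma inc_diagM (f g : A) x : (f * g) (x, x) = f (x, x) * g (x, x).
Proof.
rewrite incME (bigD1 x) //= big1 ?addr0 // => z zx.
have [xz|xz] := boolP (x <= z)%O; last by rewrite inc_out ?mul0r.
by rewrite [g _]inc_out ?mulr0 //; apply: contra zx => zx; rewrite eq_le zx.
Qed.

(** * Matrix units, triangularity and the centre *)

(** The matrix unit e_xy; truncation by [mk] makes it zero unless [x <= y], whence the side
    conditions below. *)
Definition inc_delta x y : A := mk (fun a b => ((a == x) && (b == y))%:R).
Local Notation e := inc_delta.

Lemma deltaE x y a b : (x <= y)%O -> e x y (a, b) = ((a == x) && (b == y))%:R.
Proof.
move=> xy; rewrite mkE; case: ifPn => // ab.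
by case: eqP => // ax; case: eqP => // yb; rewrite ax yb xy in ab.
Qed.

Lemma mul_deltal x y (f : A) a b :
  (x <= y)%O -> (e x y * f) (a, b) = (a == x)%:R * f (y, b).
Proof.
move=> xy; rewrite incME (bigD1 y) //= deltaE // eqxx andbT big1 ?addr0 //.
by move=> z /negbTE zy; rewrite deltaE // zy andbF mul0r.
Qed.

Lemma mul_deltar x y (f : A) a b :
  (x <= y)%O -> (f * e x y) (a, b) = f (a, x) * (b == y)%:R.
Proof.
move=> xy; rewrite incME (bigD1 x) //= deltaE // eqxx big1 ?addr0 //.
move=> z /negbTE zx; rewrite deltaE // zx; apply: mulr0.
Qed.

Lemma mul_delta x y z w : (x <= y)%O -> (z <= w)%O ->
  e x y * e z w = if y == z then e x w else 0.
Proof.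
move=> xy zw; apply: inc_ext => a b; rewrite mul_deltal // deltaE //.
have [yz|_] := eqVneq y z; last by rewrite inc0E; apply: mulr0.
by rewrite deltaE ?mulrA -?natrM ?mulnb //; apply: le_trans xy _; rewrite yz.
Qed.

Lemma delta_neq0 x y : (x <= y)%O -> e x y != 0.
Proof.
move=> xy; apply/eqP => /(congr1 (fun f : A => f (x, y))).
by rewrite deltaE // inc0E !eqxx => /eqP; rewrite oner_eq0.
Qed.

Lemma inc_deltaP (P : A -> Prop) :
  P 0 -> (forall f g, P f -> P g -> P (f + g)) ->
  (forall c x y, (x <= y)%O -> P (c *: e x y)) -> forall f, P f.
Proof.
move=> P0 PD Pe f.
have -> : f = \sum_(p | (p.1 <= p.2)%O) f p *: e p.1 p.2.
  apply: inc_ext => x y; rewrite inc_sumE.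
  have [xy|xy] := boolP (x <= y)%O.
    rewrite (bigD1 (x, y)) //= incZE deltaE // !eqxx mulr1 big1 ?addr0 //.
    case=> a b /= /andP[ab abxy]; rewrite incZE deltaE //.
    by move: abxy; rewrite xpair_eqE eq_sym [b == y]eq_sym => /negbTE ->; rewrite mulr0.
  by rewrite inc_out // big1 // => p _; rewrite incZE inc_out ?mulr0.
by apply: (big_ind P) => // -[x y] /= xy; apply: Pe.
Qed.

Lemma sum_delta : \sum_x e x x = 1.
Proof.
apply: inc_ext => x y; rewrite inc_sumE inc1E (bigD1 x) //= big1 ?addr0.
  by rewrite deltaE // eqxx eq_sym.
by move=> z /negbTE zx; rewrite deltaE // eq_sym zx.
Qed.

(* Triangularity: at a maximal row index p of the support of the column, the
   equation M = E M reads M(p, q) = E(p, p) M(p, q). *)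
Lemma diag_neq0l (E M : A) p0 q : E * M = M -> M (p0, q) != 0 ->
  exists2 p, E (p, p) != 0 & M (p, q) != 0.
Proof.
move=> EM M0; pose c (p : X) := #|[pred r : X | (r <= p)%O]|.
have [p Mp pmax] := @arg_maxnP X p0 (fun p => M (p, q) != 0) c M0.
exists p => //; apply: contra Mp => /eqP Ep.
rewrite -EM incME big1 // => r _; have [->|rp] := eqVneq r p.
  by rewrite Ep mul0r.
have [pr|pr] := boolP (p <= r)%O; last by rewrite inc_out ?mul0r.
have [->|Mr] := eqVneq (M (r, q)) 0; first by rewrite mulr0.
have : (c r <= c p)%N := pmax r Mr; rewrite leqNgt => /negP[]; apply: proper_card.
apply/properP; split; first by apply/subsetP => t; rewrite !inE => /le_trans; apply.
exists r; first by rewrite inE.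
by rewrite inE; apply: contra rp => rp; rewrite eq_le rp.
Qed.

(** Dually, at a minimal column index [q] of the support of row [p], [M * E = M] reads
    [M (p, q) = M (p, q) * E (q, q)]. Maximising the size [c] of the up-set produces such a [q]. *)
Lemma diag_neq0r (E M : A) p q0 : M * E = M -> M (p, q0) != 0 ->
  exists2 q, E (q, q) != 0 & M (p, q) != 0.
Proof.
move=> ME M0; pose c (q : X) := #|[pred r : X | (q <= r)%O]|.
have [q Mq qmax] := @arg_maxnP X q0 (fun q => M (p, q) != 0) c M0.
exists q => //; apply: contra Mq => /eqP Eq.
rewrite -ME incME big1 // => r _; have [->|rq] := eqVneq r q.
  by rewrite Eq mulr0.
have [qr|qr] := boolP (r <= q)%O; last by rewrite [E _]inc_out ?mulr0.
have [->|Mr] := eqVneq (M (p, r)) 0; first by rewrite mul0r.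
have : (c r <= c q)%N := qmax r Mr; rewrite leqNgt => /negP[]; apply: proper_card.
apply/properP; split; first by apply/subsetP => t; rewrite !inE => /(le_trans qr).
exists r; first by rewrite inE.
by rewrite inE; apply: contra rq => rq; rewrite eq_le rq andbT.
Qed.

Lemma inc_neq0P (f : A) : f != 0 -> exists x y, f (x, y) != 0.
Proof.
move=> f0; have [/existsP[[x y] fxy]|/existsPn f00] :=
  boolP [exists p : X * X, f p != 0]; first by exists x, y.
case/eqP: f0; apply: inc_ext => x y; rewrite inc0E.
by apply/eqP; move: (f00 (x, y)); rewrite negbK.
Qed.

(** Commuting with [e y y] kills the off-diagonal entries of column [y]; commuting with [e x y]
    equates the diagonal entries at [x] and [y], and connectedness propagates this. *)
Lemma inc_center_scalar (u : A) : poset_connected X ->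
  (forall f, u * f = f * u) -> exists c : F, u = c *: (1 : A).
Proof.
move=> hX uC.
have u_off x y : x != y -> u (x, y) = 0.
  move=> xy; have := congr1 (fun f : A => f (x, y)) (uC (e y y)).
  by rewrite mul_deltal // mul_deltar // eqxx mulr1 (negbTE xy) mul0r.
have u_diag x y : (x <= y)%O -> u (x, x) = u (y, y).
  move=> xy; have := congr1 (fun f : A => f (x, y)) (uC (e x y)).
  by rewrite mul_deltal // mul_deltar // !eqxx mulr1 mul1r.
have u_conn x y : u (x, x) = u (y, y).
  have [p + ->] := connectP (hX x y).
  elim: p x => //= z p IH x /andP[xz /IH <-].
  by have /orP[/u_diag|/u_diag] := xz.
case: (pickP [pred x : X | true]) => [x0 _|X0].
  exists (u (x0, x0)); apply: inc_ext => x y; rewrite incZE inc1E.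
  by have [->|/u_off ->] := eqVneq x y; rewrite ?mulr1 ?mulr0.
by exists 0; apply: inc_ext => x; have := X0 x.
Qed.

(** The abstract product [m] lets one reduction to matrix units serve both the multiplicative and
    the antimultiplicative case. *)
Lemma bilinear_morph (psi : {linear A -> A}) (m : A -> A -> A) :
  (forall f, m f 0 = 0) -> (forall f, m 0 f = 0) ->
  (forall f g h, m f (g + h) = m f g + m f h) ->
  (forall f g h, m (f + g) h = m f h + m g h) ->
  (forall c f g, m f (c *: g) = c *: m f g) ->
  (forall c f g, m (c *: f) g = c *: m f g) ->
  (forall x y z w, (x <= y)%O -> (z <= w)%O ->
     psi (e x y * e z w) = m (psi (e x y)) (psi (e z w))) ->
  forall f g, psi (f * g) = m (psi f) (psi g).
Proof.
move=> m0r m0l mDr mDl mZr mZl me f g.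
elim/inc_deltaP: f => [|f f' IH IH'|a x y xy].
- by rewrite mul0r linear0 m0l.
- by rewrite mulrDl !linearD mDl IH IH'.
elim/inc_deltaP: g => [|g g' IH IH'|b z w zw].
- by rewrite mulr0 linear0 m0r.
- by rewrite mulrDr !linearD mDr IH IH'.
by rewrite -inc_scaleAl -inc_scaleAr !linearZ mZl mZr me.
Qed.

Lemma inc_torsion_free n (f : A) : n%:R != 0 :> F -> f *+ n = 0 -> f = 0.
Proof. by move=> n0 /eqP; rewrite -scaler_nat scaler_eq0 (negbTE n0) => /eqP. Qed.

(** The hypotheses compare the coefficients of 1, [c] and [c^2] in the expanded square. *)
Lemma idempotent_perturb c (a b : A) :
  a * a = a -> a * b + b * a = b -> b * b = 0 ->
  (a + c *: b) * (a + c *: b) = a + c *: b.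
Proof.
move=> aa ab bb; rewrite mulrDl !mulrDr -!(inc_scaleAl, inc_scaleAr) aa bb.
by rewrite !scaler0 addr0 -addrA -scalerDr ab.
Qed.

Lemma orthogonal_perturb c (a b s t : A) :
  a * s = 0 -> a * t = b * s -> b * t = 0 -> (a + c *: b) * (s - c *: t) = 0.
Proof.
move=> as0 atE bt; rewrite mulrDl !mulrBr -!(inc_scaleAl, inc_scaleAr) as0 atE bt.
by rewrite !scaler0 subr0 sub0r addNr.
Qed.

(** * Unital linear bijections preserving orthogonality of idempotents *)

Section OrthogonalityPreserver.
Variable psi : {linear A -> A}.
Hypothesis two_neq0 : 2%:R != 0 :> F.
Hypothesis psi_bij : bijective psi.
Hypothesis psi1 : psi 1 = 1.
Hypothesis psi_orth : forall f g, f * f = f -> g * g = g ->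
  f * g = 0 -> g * f = 0 -> psi f * psi g = 0.

Local Notation E x := (psi (e x x)).
Local Notation N x y := (psi (e x y)).

Lemma psi_neq0 f : f != 0 -> psi f != 0.
Proof. by apply: contraNneq => /eqP; rewrite (raddf_eq0 _ (bij_inj psi_bij)). Qed.

(* Polarisation over c = 1, -1 of the orthogonality of a + c b and s - c t. *)
Lemma psi_polar (a b s t : A) :
  a * a = a -> a * b + b * a = b -> b * b = 0 ->
  s * s = s -> s * t + t * s = t -> t * t = 0 ->
  a * s = 0 -> a * t = b * s -> b * t = 0 ->
  s * a = 0 -> t * a = s * b -> t * b = 0 ->
  psi b * psi s = psi a * psi t.
Proof.
move=> aa ab bb ss st tt as0 atE bt sa ta tb.
have orth c : (psi a + c *: psi b) * (psi s - c *: psi t) = 0.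
  rewrite -!linearZ -linearD -linearB; apply: psi_orth.
  - exact: idempotent_perturb.
  - by rewrite -scaleNr; apply: idempotent_perturb.
  - exact: orthogonal_perturb.
  have := orthogonal_perturb (- c) sa (esym ta) tb.
  by rewrite !scaleNr opprK.
have ps0 : psi a * psi s = 0 by apply: psi_orth.
set w := psi b * psi s - psi a * psi t.
have wB : w - psi b * psi t = 0.
  have := orth 1; rewrite !scale1r mulrDl !mulrBr ps0 sub0r => <-.
  by rewrite addrA [- _ + _]addrC.
have wD : w + psi b * psi t = 0.
  apply: oppr_inj; have := orth (- 1); rewrite oppr0 !scaleN1r opprK mulrBl => <-.
  by rewrite !mulrDr ps0 add0r !opprD opprK addrA [- _ + _]addrC.
apply/eqP; rewrite -subr_eq0; apply/eqP; apply: (inc_torsion_free two_neq0).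
by have := congr2 +%R wB wD; rewrite addrACA addNr !addr0 mulr2n.
Qed.

(** Idempotency of [E x] is not assumed: it follows by multiplying [1 = \sum_z E z] by [E x]. *)
Lemma psi_delta_mul x y : E x * E y = if x == y then E x else 0.
Proof.
have E0 z w : z != w -> E z * E w = 0.
  by move=> zw; apply: psi_orth; rewrite mul_delta // ?eqxx ?[w == z]eq_sym ?(negbTE zw).
case: eqVneq => [<-|/E0 //]; rewrite -[RHS]mulr1 -psi1 -sum_delta linear_sum.
by rewrite (bigD1 x) //= mulrDr mulr_sumr big1 ?addr0 // => z xz; rewrite E0 // eq_sym.
Qed.

Lemma psi_delta_sum : \sum_x E x = 1.
Proof. by rewrite -linear_sum sum_delta. Qed.

Lemma delta_perturb x y : (x < y)%O -> (e x x + e x y) * (e x x + e x y) = e x x + e x y.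
Proof.
move=> xy; rewrite -[e x y]scale1r; apply: idempotent_perturb.
all: by rewrite !mul_delta ?(ltW xy) // ?eqxx ?(gt_eqF xy) ?addr0.
Qed.

(** The idempotent [e x x + e x y] is orthogonal to [e z z], and the contribution of [E x] is
    already zero. *)
Lemma psi_off x y z : (x < y)%O -> z != x -> z != y ->
  E z * N x y = 0 /\ N x y * E z = 0.
Proof.
move=> xy zx zy; have [xz yz] : (x == z) = false /\ (y == z) = false.
  by split; apply/negbTE; rewrite eq_sym.
have Ezx : E z * E x = 0 by rewrite psi_delta_mul (negbTE zx).
have Exz : E x * E z = 0 by rewrite psi_delta_mul xz.
have zp : e z z * (e x x + e x y) = 0.
  by rewrite mulrDr !mul_delta ?(ltW xy) // (negbTE zx) addr0.
have pz : (e x x + e x y) * e z z = 0.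
  by rewrite mulrDl !mul_delta ?(ltW xy) // xz yz addr0.
have zz : e z z * e z z = e z z by rewrite mul_delta // eqxx.
have := psi_orth zz (delta_perturb xy) zp pz.
have := psi_orth (delta_perturb xy) zz pz zp.
by rewrite linearD mulrDl mulrDr Exz Ezx !add0r.
Qed.

(** Polarises the orthogonal idempotents [e x x + c e x y] and [e y y - c e x y], in both orders. *)
Lemma psi_swap x y : (x < y)%O -> N x y * E y = E x * N x y /\ N x y * E x = E y * N x y.
Proof.
move=> xy; have yx := gt_eqF xy; have xyF := lt_eqF xy.
split; [apply: (@psi_polar (e x x) (e x y) (e y y) (e x y))
       |apply: (@psi_polar (e y y) (e x y) (e x x) (e x y))].
all: by rewrite ?mul_delta ?(ltW xy) // ?eqxx ?yx ?xyF ?addr0 ?add0r.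
Qed.

(** Polarises [e y y + e x y + c (e y z + e x z)] against [e z z - c e y z]; the terms related by
    [psi_swap] then cancel. *)
Lemma psi_chain x y z : (x < y)%O -> (y < z)%O ->
  N x z * E z = N x y * N y z /\ E z * N x z = N y z * N x y.
Proof.
move=> xy yz; have xz := lt_trans xy yz.
have [zNy yNz] := psi_off xy (negbT (gt_eqF xz)) (negbT (gt_eqF yz)).
have [swap1 swap2] := psi_swap yz.
have rel := (gt_eqF xy, lt_eqF xy, gt_eqF yz, lt_eqF yz, gt_eqF xz, lt_eqF xz, eqxx).
have [p1 p2] : (N y z + N x z) * E z = (E y + N x y) * N y z /\
               N y z * (E y + N x y) = E z * (N y z + N x z).
  rewrite -!linearD; split;
    [apply: (@psi_polar (e y y + e x y) (e y z + e x z) (e z z) (e y z))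
    |apply: (@psi_polar (e z z) (e y z) (e y y + e x y) (e y z + e x z))];
  rewrite ?mulrDl ?mulrDr ?mul_delta ?(ltW xy) ?(ltW yz) ?(ltW xz) //;
  by rewrite !rel ?addr0 ?add0r // addrC.
split; first by apply: (addrI (N y z * E z)); rewrite -mulrDl p1 mulrDl swap1.
by apply: (addrI (E z * N y z)); rewrite -mulrDr -p2 mulrDr swap2.
Qed.

Lemma psi_split x y : (x < y)%O -> N x y = E x * N x y + E y * N x y.
Proof.
move=> xy; rewrite -[LHS]mul1r -psi_delta_sum mulr_suml (bigD1 x) //=.
rewrite (bigD1 y) ?(gt_eqF xy) //= big1 ?addr0 // => z /andP[zx zy].
by have [] := psi_off xy zx zy.
Qed.

(** By triangularity a nonzero idempotent has a nonzero diagonal entry, and orthogonal ones share no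
    such position. The diagonal supports of the [E x] are thus disjoint and nonempty, one per point
    of the finite [X], hence singletons. *)
Lemma psi_diag : exists2 pi : X -> X, injective pi &
  forall x p, (E x (p, p) != 0) = (p == pi x).
Proof.
have dE x : exists p, E x (p, p) != 0.
  have /inc_neq0P[p [q Epq]] := psi_neq0 (delta_neq0 (lexx x)).
  have EE : E x * E x = E x by rewrite psi_delta_mul eqxx.
  by have [r Er _] := diag_neq0l EE Epq; exists r.
have [pi piE] := fin_all_exists dE.
have uniqE x y p : E x (p, p) != 0 -> E y (p, p) != 0 -> x = y.
  move=> Ex Ey; apply/eqP; apply: contraNT Ex => /negbTE xy.
  have := psi_delta_mul x y; rewrite xy => /(congr1 (fun f : A => f (p, p))).
  by rewrite inc_diagM inc0E => /eqP; rewrite mulf_eq0 (negbTE Ey) orbF.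
have pi_inj : injective pi by move=> x y pixy; apply: (uniqE _ _ (pi x)); rewrite // pixy.
exists pi => // x p; apply/idP/eqP => [Exp|-> //].
by rewrite -(f_invF pi_inj p) in Exp *; rewrite (uniqE _ _ _ Exp (piE _)).
Qed.

(** * Orientation of [pi] on comparable pairs *)

Section Permutation.
Variable pi : X -> X.
Hypothesis pi_inj : injective pi.
Hypothesis diagE : forall x p, (E x (p, p) != 0) = (p == pi x).

(** Triangularity moves a nonzero entry of [M] first to row [pi x], then to column [pi y]. *)
Lemma psi_peirce x y (M : A) :
  E x * M = M -> M * E y = M -> M != 0 -> (pi x <= pi y)%O.
Proof.
move=> EM ME /inc_neq0P[p [q]] /(diag_neq0l EM)[p']; rewrite diagE => /eqP->.
move=> /(diag_neq0r ME)[q']; rewrite diagE => /eqP->.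
by apply: contraR => xy; rewrite inc_out.
Qed.

Lemma psi_delta_idem x : E x * E x = E x.
Proof. by rewrite psi_delta_mul eqxx. Qed.

(** The other half [E y * N x y = N x y * E x] lies in the Peirce block of [(y, x)], which is zero
    unless [pi y <= pi x]. *)
Lemma psi_pos x y : (x < y)%O -> (pi x < pi y)%O ->
  E x * N x y = N x y /\ N x y * E y = N x y.
Proof.
move=> xy pixy; have [swapxy swapyx] := psi_swap xy.
suff yN0 : E y * N x y = 0.
  by rewrite swapxy; split; rewrite [RHS]psi_split // yN0 addr0.
apply/eqP; apply/negPn/negP => yN; have : (pi y <= pi x)%O.
  apply: psi_peirce yN; first by rewrite mulrA psi_delta_idem.
  by rewrite -swapyx -mulrA psi_delta_idem.
by rewrite (lt_geF pixy).
Qed.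

Lemma psi_neg x y : (x < y)%O -> (pi y < pi x)%O ->
  E y * N x y = N x y /\ N x y * E x = N x y.
Proof.
move=> xy piyx; have [swapxy swapyx] := psi_swap xy.
suff xN0 : E x * N x y = 0.
  by rewrite swapyx; split; rewrite [RHS]psi_split // xN0 add0r.
apply/eqP; apply/negPn/negP => xN; have : (pi x <= pi y)%O.
  apply: psi_peirce xN; first by rewrite mulrA psi_delta_idem.
  by rewrite -swapxy -mulrA psi_delta_idem.
by rewrite (lt_geF piyx).
Qed.

(** If [pi x] and [pi y] were incomparable, both halves of [psi_split] would vanish, against
    injectivity of [psi]. *)
Lemma pi_comparable x y : (x < y)%O -> (pi y < pi x)%O = ~~ (pi x < pi y)%O.
Proof.
move=> xy; have [/lt_gtF -> //|npos] := boolP (pi x < pi y)%O.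
have pixy : pi x != pi y by rewrite (inj_eq pi_inj) lt_eqF.
have [swapxy swapyx] := psi_swap xy.
apply: contraNT (psi_neq0 (delta_neq0 (ltW xy))) => nneg.
rewrite psi_split // -swapyx; apply/eqP.
suff [-> ->] : E x * N x y = 0 /\ N x y * E x = 0 by rewrite addr0.
split; apply/eqP; [apply: contraNT npos|apply: contraNT nneg] => NN.
  rewrite lt_neqAle pixy; apply: psi_peirce NN; first by rewrite mulrA psi_delta_idem.
  by rewrite -swapxy -mulrA psi_delta_idem.
rewrite lt_neqAle eq_sym pixy; apply: psi_peirce NN.
  by rewrite swapyx mulrA psi_delta_idem.
by rewrite -mulrA psi_delta_idem.
Qed.

(** With opposite orientations, both products of [N x y] and [N y z] contain a product of two
    distinct [E]s. So [N x z * E z] and [E z * N x z] vanish, while one of them equals [N x z]. *)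
Lemma pi_chain x y z : (x < y)%O -> (y < z)%O -> (pi x < pi y)%O = (pi y < pi z)%O.
Proof.
move=> xy yz; have xz := lt_trans xy yz; have [chain1 chain2] := psi_chain xy yz.
have xyN : E x * E y = 0 by rewrite psi_delta_mul (lt_eqF xy).
have yzN : E y * E z = 0 by rewrite psi_delta_mul (lt_eqF yz).
have zyN : E z * E y = 0 by rewrite psi_delta_mul (gt_eqF yz).
have yxN : E y * E x = 0 by rewrite psi_delta_mul (gt_eqF xy).
have absurd : N x y * N y z = 0 -> N y z * N x y = 0 -> False.
  rewrite -chain1 -chain2 => Nz zN; have /eqP[] := psi_neq0 (delta_neq0 (ltW xz)).
  have [pos|] := boolP (pi x < pi z)%O; first by rewrite -(psi_pos xz pos).2.
  by rewrite -pi_comparable // => neg; rewrite -(psi_neg xz neg).1.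
have [pos1|] := boolP (pi x < pi y)%O; have [pos2|] := boolP (pi y < pi z)%O => //.
  rewrite -pi_comparable // => neg2; exfalso.
  have [l1 r1] := psi_pos xy pos1; have [l2 r2] := psi_neg yz neg2.
  apply: absurd; first by rewrite -r1 -l2 -mulrA [E y * _]mulrA yzN mul0r mulr0.
  by rewrite -r2 -l1 -mulrA [E y * _]mulrA yxN mul0r mulr0.
rewrite -pi_comparable // => neg1; exfalso.
have [l1 r1] := psi_neg xy neg1; have [l2 r2] := psi_pos yz pos2.
apply: absurd; first by rewrite -r1 -l2 -mulrA [E x * _]mulrA xyN mul0r mulr0.
by rewrite -r2 -l1 -mulrA [E z * _]mulrA zyN mul0r mulr0.
Qed.

(** For incomparable [x] and [y], [E x * psi f * E y] vanishes on matrix units, hence for all [f]. A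
    preimage of [e (pi x) (pi y)] gives instead the nonzero entry
    [E x (pi x, pi x) * E y (pi y, pi y)]. *)
Lemma pi_reflects_comparable x y : (pi x < pi y)%O -> (x < y)%O || (y < x)%O.
Proof.
move=> pixy; apply/negPn/negP; rewrite negb_or => /andP[nxy nyx].
have xy : x != y by apply: contraTneq pixy => ->; rewrite ltxx.
have [psi' _ psi'K] := psi_bij; pose g := e (pi x) (pi y).
have zero f : E x * psi f * E y = 0.
  elim/inc_deltaP: f => [|f g' IH IH'|c a b ab].
  - by rewrite linear0 mulr0 mul0r.
  - by rewrite linearD mulrDr mulrDl IH IH' addr0.
  rewrite linearZ -inc_scaleAr -inc_scaleAl.
  suff -> : E x * N a b * E y = 0 by rewrite scaler0.
  have [<-|neq_ab] := eqVneq a b.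
    rewrite psi_delta_mul; have [_|_] := eqVneq x a; last by rewrite mul0r.
    by rewrite psi_delta_mul (negbTE xy).
  have {neq_ab}ab : (a < b)%O by rewrite lt_neqAle neq_ab.
  have [xa|xa] := eqVneq x a; last first.
    have [xb|xb] := eqVneq x b; last by rewrite (psi_off ab xa xb).1 mul0r.
    have [ya|ya] := eqVneq y a; first by rewrite -xb -ya (negbTE nyx) in ab.
    by rewrite -mulrA (psi_off ab ya _).2 ?mulr0 // -xb eq_sym.
  have [yb|yb] := eqVneq y b; first by rewrite -xa -yb (negbTE nxy) in ab.
  by rewrite -mulrA (psi_off ab _ yb).2 ?mulr0 // -xa eq_sym.
have := congr1 (fun f : A => f (pi x, pi y)) (zero (psi' g)).
rewrite psi'K incME (bigD1 (pi y)) //= mul_deltar ?ltW // eqxx mulr1 big1.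
  rewrite addr0 inc0E => /eqP; rewrite mulf_eq0 => /orP[]; apply/negP.
    by rewrite diagE.
  by rewrite diagE.
by move=> z /negbTE zy; rewrite mul_deltar ?ltW // zy mulr0 mul0r.
Qed.

(** Opposite orientations give [pi z < pi x < pi y], so [y] and [z] are comparable and form with [x]
    a chain violating [pi_chain]. *)
Lemma pi_wedge_up x y z : (x < y)%O -> (x < z)%O ->
  (pi x < pi y)%O = (pi x < pi z)%O.
Proof.
wlog suff wedge : y z / (x < y)%O -> (x < z)%O ->
    (pi x < pi y)%O -> (pi x < pi z)%O.
  by move=> xy xz; apply/idP/idP; apply: wedge.
move=> xy xz pxy; apply/negPn/negP; rewrite -pi_comparable // => pzx.
have pzy := lt_trans pzx pxy.
have /orP[zy|yz] := pi_reflects_comparable pzy.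
  by have := pi_chain xz zy; rewrite pzy (lt_gtF pzx).
by have := pi_chain xy yz; rewrite pxy (lt_gtF pzy).
Qed.

Lemma pi_wedge_down x y z : (y < x)%O -> (z < x)%O ->
  (pi y < pi x)%O = (pi z < pi x)%O.
Proof.
wlog suff wedge : y z / (y < x)%O -> (z < x)%O ->
    (pi y < pi x)%O -> (pi z < pi x)%O.
  by move=> yx zx; apply/idP/idP; apply: wedge.
move=> yx zx pyx; apply/negPn/negP; rewrite -pi_comparable // => pxz.
have pyz := lt_trans pyx pxz.
have /orP[yz|zy] := pi_reflects_comparable pyz.
  by have := pi_chain yz zx; rewrite pyz (lt_gtF pxz).
by have := pi_chain zy yx; rewrite pyx (lt_gtF pyz).
Qed.

(** Orientation of all pairs through [x]: [true] for preserved, [false] for reversed. A point with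
    no comparable partner has both signs. *)
Definition pi_sign (b : bool) x := forall y,
  ((x < y)%O -> (pi x < pi y)%O = b) /\ ((y < x)%O -> (pi y < pi x)%O = b).

Lemma pi_sign_exists x : exists b, pi_sign b x.
Proof.
have [y xy|max_x] := pickP [pred y | (x < y)%O].
  exists (pi x < pi y)%O => z; split=> [xz|zx].
    by rewrite (pi_wedge_up xz xy).
  by rewrite (pi_chain zx xy).
have [y yx|min_x] := pickP [pred y | (y < x)%O].
  exists (pi y < pi x)%O => z; split=> [xz|zx]; first by rewrite (pi_chain yx xz).
  by rewrite (pi_wedge_down zx yx).
by exists true => y; split=> [xy|yx]; [have := max_x y|have := min_x y]; rewrite /= ?xy ?yx.
Qed.

Lemma pi_sign_adjacent b x y : (x >=< y)%O -> pi_sign b x -> pi_sign b y.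
Proof.
have [<- //|xy] := eqVneq x y.
have [c cy] := pi_sign_exists y; case/orP => [le_xy|le_yx] bx.
  have lt_xy : (x < y)%O by rewrite lt_neqAle xy.
  by have [/(_ lt_xy) <- _] := bx y; rewrite (cy x).2.
have lt_yx : (y < x)%O by rewrite lt_neqAle eq_sym xy.
by have [_ /(_ lt_yx) <-] := bx y; rewrite (cy x).1.
Qed.

Lemma pi_sign_constant : poset_connected X -> exists b, forall x, pi_sign b x.
Proof.
move=> hX; have [x _|X0] := pickP [pred x : X | true]; last first.
  by exists true => x; have := X0 x.
have [b bx] := pi_sign_exists x; exists b => y.
have [p + ->] := connectP (hX x y); elim: p x bx => //= z p IH x bx /andP[xz].
by apply: IH; apply: pi_sign_adjacent bx.
Qed.

(** * From constant orientation to (anti)multiplicativity *)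

Lemma psi_multiplicative : (forall x, pi_sign true x) ->
  forall f g, psi (f * g) = psi f * psi g.
Proof.
move=> pos; have typ x y : (x <= y)%O -> E x * N x y = N x y /\ N x y * E y = N x y.
  rewrite le_eqVlt => /predU1P[->|xy]; first by rewrite psi_delta_idem.
  by apply: (psi_pos xy); rewrite (pos x y).1.
apply: bilinear_morph => [f|f|f g h|f g h|c f g|c f g|x y z w xy zw].
- exact: mulr0.
- exact: mul0r.
- exact: mulrDr.
- exact: mulrDl.
- by rewrite inc_scaleAr.
- by rewrite inc_scaleAl.
(* Mismatched units die through [E y * E z = 0]; matching ones reduce to [typ] if one is diagonal,
   and to [psi_chain] otherwise. *)
rewrite mul_delta //; have [yz|yz] := eqVneq y z; last first.
  rewrite linear0 -(typ _ _ xy).2 -(typ _ _ zw).1 -mulrA [E y * _]mulrA.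
  by rewrite psi_delta_mul (negbTE yz) mul0r mulr0.
subst z; move: xy zw; rewrite le_eqVlt => /predU1P[->|xy] yw; first by rewrite (typ y w yw).1.
move: yw; rewrite le_eqVlt => /predU1P[<-|yw]; first by rewrite (typ x y (ltW xy)).2.
by rewrite -(psi_chain xy yw).1 (typ x w _).2 // ltW // (lt_trans xy).
Qed.

Lemma psi_antimultiplicative : (forall x, pi_sign false x) ->
  forall f g, psi (f * g) = psi g * psi f.
Proof.
move=> neg; have typ x y : (x <= y)%O -> E y * N x y = N x y /\ N x y * E x = N x y.
  rewrite le_eqVlt => /predU1P[->|xy]; first by rewrite psi_delta_idem.
  by apply: (psi_neg xy); rewrite pi_comparable // (neg x y).1.
apply: (bilinear_morph (m := fun f g => g * f))
  => [f|f|f g h|f g h|c f g|c f g|x y z w xy zw].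
- exact: mul0r.
- exact: mulr0.
- exact: mulrDl.
- exact: mulrDr.
- by rewrite inc_scaleAl.
- by rewrite inc_scaleAr.
rewrite mul_delta //; have [yz|yz] := eqVneq y z; last first.
  rewrite linear0 -(typ _ _ xy).1 -(typ _ _ zw).2 -mulrA [E z * _]mulrA.
  by rewrite psi_delta_mul eq_sym (negbTE yz) mul0r mulr0.
subst z; move: xy zw; rewrite le_eqVlt => /predU1P[->|xy] yw; first by rewrite (typ y w yw).2.
move: yw; rewrite le_eqVlt => /predU1P[<-|yw]; first by rewrite (typ x y (ltW xy)).1.
by rewrite -(psi_chain xy yw).2 (typ x w _).1 // ltW // (lt_trans xy).
Qed.

End Permutation.

Lemma orthogonality_preserver : poset_connected X ->
  (forall f g, psi (f * g) = psi f * psi g) \/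
  (forall f g, psi (f * g) = psi g * psi f).
Proof.
move=> hX; have [pi pi_inj diagE] := psi_diag.
have [[] sgn] := pi_sign_constant pi_inj diagE hX.
  by left; apply: psi_multiplicative diagE sgn.
by right; apply: psi_antimultiplicative pi_inj diagE sgn.
Qed.

End OrthogonalityPreserver.

End IncidenceAlgebra.

(** * Reduction of tripotent preservers to the unital case *)

Theorem theorem6p6 (d : Order.disp_t) (X : finPOrderType d) (F : fieldType)
  (hX : poset_connected X)
  (h2 : 2%N \notin [pchar F]) (h3 : 3%N \notin [pchar F])
  (phi : incidence X F -> incidence X F)
  (hlin : F_linear phi) (hbij : bijective phi)
  (htri : forall f, tripotent f -> tripotent (phi f)) :
  exists (r : F) (psi : incidence X F -> incidence X F),
    (r = 1 \/ r = -1) /\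
    (inc_automorphism psi \/ inc_antiautomorphism psi) /\
    (forall f, phi f = inc_scale r (psi f)).
Proof.
pose A := incidence X F;
have [phiD phiZ] := hlin.
have [two_neq0 three_neq0] : 2%:R != 0 :> F /\ 3%:R != 0 :> F by move: h2 h3; rewrite !inE.
(* The zero algebra is set apart: [c != 0] below relies on [1 != 0]. *)
have [one0|one_neq0] := eqVneq (1 : A) 0.
  have triv (f g : A) : f = g by rewrite -[f]mulr1 -[g]mulr1 one0 !mulr0.
  by exists 1, phi; split; [left|split=> [|f]; [left; split|]].
have phi_lin : linear (phi : A -> A).
  by move=> a f g; apply: etrans (phiD _ _) _; congr (_ + _); apply: phiZ.
pose phiL : {linear A -> A} := HB.pack phi (GRing.isLinear.Build F A A _ phi phi_lin).
have phi_inj : injective phiL := bij_inj hbij.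
have tri (f : A) : f * (f * f) = f -> phiL f * (phiL f * phiL f) = phiL f := htri f.
(* For orthogonal idempotents, [f + g] is idempotent and [(f - g)^2 = f + g], so [f], [g] and
   [f +- g] are all tripotent. *)
have orth (f g : A) : f * f = f -> g * g = g -> f * g = 0 -> g * f = 0 ->
    phiL f * phiL g = 0 /\ phiL g * phiL f = 0.
  move=> ff gg fg gf.
  have DD : (f + g) * (f + g) = f + g.
    by rewrite mulrDl !mulrDr ff gg fg gf addr0 add0r.
  have BB : (f - g) * (f - g) = f + g.
    by rewrite mulrBl !mulrBr ff gg fg gf subr0 sub0r opprK.
  have BD : (f - g) * (f + g) = f - g.
    by rewrite mulrBl !mulrDr ff gg fg gf addr0 add0r.
  apply: tripotent_orthogonal.
  - by move=> h; apply: inc_torsion_free.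
  - by move=> h; apply: inc_torsion_free.
  - by apply: tri; rewrite !ff.
  - by apply: tri; rewrite !gg.
  - by rewrite -linearD; apply: tri; rewrite !DD.
  - by rewrite -linearB; apply: tri; rewrite BB BD.
have comm_idem (f : A) : f * f = f -> phiL 1 * phiL f = phiL f * phiL 1.
  move=> ff; have fg : f * (1 - f) = 0 by rewrite mulrBr mulr1 ff subrr.
  have gf : (1 - f) * f = 0 by rewrite mulrBl mul1r ff subrr.
  have gg : (1 - f) * (1 - f) = 1 - f by rewrite mulrBr mulr1 gf subr0.
  have [FG GF] := orth f (1 - f) ff gg fg gf.
  have -> : phiL 1 = phiL f + phiL (1 - f) by rewrite -linearD addrC subrK.
  by rewrite mulrDl mulrDr GF FG.
(* By surjectivity it suffices to treat images of matrix units; for [x < y], [e_xy] is the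
   difference of the idempotents [e_xx + e_xy] and [e_xx]. *)
have central (g : A) : phiL 1 * g = g * phiL 1.
  have [phi' _ phi'K] := hbij; have <- : phiL (phi' g) = g := phi'K g.
  elim/(@inc_deltaP d X F): (phi' g) => [|f f' IH IH'|a x y xy].
  - by rewrite linear0 mulr0 mul0r.
  - by rewrite linearD mulrDr mulrDl IH IH'.
  rewrite linearZ -inc_scaleAr -inc_scaleAl; congr (_ *: _).
  have comm_diag : phiL 1 * phiL (inc_delta F x x) = phiL (inc_delta F x x) * phiL 1.
    by apply: comm_idem; rewrite mul_delta // eqxx.
  move: xy; rewrite le_eqVlt => /predU1P[<- //|xy].
  have := comm_idem _ (delta_perturb F xy).
  by rewrite linearD mulrDl mulrDr comm_diag => /addrI.
have [c phi1] := inc_center_scalar hX central.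
have c_sqr : c = 1 \/ c = -1.
  have c_neq0 : c != 0.
    apply: contra one_neq0 => /eqP c0; apply/eqP/phi_inj.
    by rewrite phi1 c0 scale0r linear0.
  have : c * (c * c) = c.
    have := tri 1; rewrite phi1 !mulr1 => /(_ erefl).
    rewrite -!(inc_scaleAl, inc_scaleAr) !mulr1 !scalerA => /eqP.
    rewrite -subr_eq0 -scalerBl scaler_eq0 (negbTE one_neq0) orbF subr_eq0.
    by rewrite mulrA => /eqP.
  rewrite -[RHS]mulr1 => /(mulfI c_neq0) /eqP; rewrite -expr2 sqrf_eq1.
  by case/orP => /eqP; [left|right].
have cc : c * c = 1 by case: c_sqr => ->; rewrite ?mulrNN mulr1.
(* As [c] is its own inverse, this scaling is unital and [phi = c psi]. *)
pose psi (f : A) : A := c *: phiL f.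
have psi_lin : linear psi.
  by move=> a f g; rewrite /psi linearP scalerDr !scalerA mulrC.
pose psiL : {linear A -> A} := HB.pack psi (GRing.isLinear.Build F A A _ psi psi_lin).
have psi_bij : bijective psiL.
  have [phi' phiK phi'K] := hbij; exists (fun f => phi' (c *: f)) => f.
    by rewrite /= /psi scalerA cc scale1r phiK.
  by rewrite /= /psi [phiL _]phi'K scalerA cc scale1r.
have psi1 : psiL 1 = 1 by rewrite /= /psi phi1 scalerA cc scale1r.
have psi_orth (f g : A) : f * f = f -> g * g = g -> f * g = 0 -> g * f = 0 ->
    psiL f * psiL g = 0.
  move=> ff gg fg gf; rewrite /= /psi -inc_scaleAl -inc_scaleAr.
  by rewrite (orth f g ff gg fg gf).1 !scaler0.
have psi_Flin : F_linear psi.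
  by split=> [f g|a f]; [apply: (linearD psiL)|exact: (linearZZ psiL a f)].
exists c, psi; split=> //; split; last first.
  by move=> f; rewrite -[inc_scale _ _]/(c *: (c *: phiL f)) scalerA cc scale1r.
by have [mulP|mulP] := orthogonality_preserver two_neq0 psi_bij psi1 psi_orth hX;
  [left|right]; split.
Qed.
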